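(* The minimum size of a self-identifying code of $K_3\times P_n$ is \[ \gamma^{\mathrm{SID}}(K_3\times P_n)=\begin{cases}9,& n=3,\\ 12,& n=4\text{ or }5,\\ 14,& n=6.\end{cases} \]
   Context: For a vertex $v$, $N[v]$ is its closed neighborhood. A nonempty set $S\subseteq V(G)$ is a self-identifying code of $G$ if for every vertex $v\in V(G)$: (1) $N[v]\cap S\neq\emptyset$, and (2) $\bigcap_{c\in N[v]\cap S}N[c]=\{v\}$; $\gamma^{\mathrm{SID}}(G)$ is the minimum size of such a code. With $V(K_m)=\{v_0,\dots,v_{m-1}\}$ and $V(P_n)=\{0,\dots,n-1\}$ (consecutively numbered path), the direct product $K_m\times P_n$ has vertices $(v_i,j)$, with $(v_i,j)$ adjacent to $(v_{i'},j')$ iff $i\neq i'$ and $|j-j'|=1$. *)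

(* Defs.v *)
From mathcomp Require Import all_boot.

Set Implicit Arguments.
Unset Strict Implicit.
Unset Printing Implicit Defensive.

Record sgraph := SGraph {
  vertex :> finType;
  edge : rel vertex;
  edge_sym : symmetric edge;
  edge_irrefl : irreflexive edge }.

Section SelfIdentifyingCodes.
Variable G : sgraph.

Definition closed_nbhd (v : G) : {set G} := [set u | (u == v) || edge v u].

Definition self_identifying_code (S : {set G}) : Prop :=
  S != set0 /\
  forall v : G,
    closed_nbhd v :&: S != set0 /\
    \bigcap_(c in closed_nbhd v :&: S) closed_nbhd c = [set v].

(* A relation rather than a function: some graphs have no self-identifying
   code, so the minimum size need not exist; when it does, it is unique. *)
Definition is_gammaSID (k : nat) : Prop :=
  (exists S : {set G}, self_identifying_code S /\ #|S| = k) /\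
  (forall S : {set G}, self_identifying_code S -> k <= #|S|).

End SelfIdentifyingCodes.

Definition complete_rel (m : nat) : rel 'I_m := fun i j => i != j.

Lemma complete_rel_sym m : symmetric (@complete_rel m).
Proof. by move=> i j; rewrite /complete_rel eq_sym. Qed.

Lemma complete_rel_irrefl m : irreflexive (@complete_rel m).
Proof. by move=> i; rewrite /complete_rel eqxx. Qed.

Definition complete_graph (m : nat) : sgraph :=
  SGraph (@complete_rel_sym m) (@complete_rel_irrefl m).

Definition path_rel (n : nat) : rel 'I_n :=
  fun i j => (i.+1 == j :> nat) || (j.+1 == i :> nat).

Lemma path_rel_sym n : symmetric (@path_rel n).
Proof. by move=> i j; rewrite /path_rel orbC. Qed.

Lemma path_rel_irrefl n : irreflexive (@path_rel n).
Proof. by move=> i; rewrite /path_rel orbb gtn_eqF. Qed.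

Definition path_graph (n : nat) : sgraph :=
  SGraph (@path_rel_sym n) (@path_rel_irrefl n).

Definition direct_rel (G H : sgraph) : rel (G * H)%type :=
  fun x y => edge x.1 y.1 && edge x.2 y.2.

Lemma direct_rel_sym G H : symmetric (@direct_rel G H).
Proof.
by move=> x y; rewrite /direct_rel (edge_sym x.1) (edge_sym x.2).
Qed.

Lemma direct_rel_irrefl G H : irreflexive (@direct_rel G H).
Proof. by move=> x; rewrite /direct_rel edge_irrefl. Qed.

Definition direct_product (G H : sgraph) : sgraph :=
  SGraph (@direct_rel_sym G H) (@direct_rel_irrefl G H).

(* Main.v *)
(** For [j != j'], a codeword separating [(i, j)] from [(i, j')] is either
    [(i, j)] itself or lies over a neighbour of [j] that is not a neighbour of
    [j'].  Taking for [j] an end of the path and for [j'] the vertex at distance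
    two leaves only [(i, j)], so the end columns are full; separating [(i, j)]
    from its neighbours [(i', j1)] makes the column next to an end full too.
    These four columns account for everything up to [n = 5].  For [n = 6] the
    same separation in the two middle columns shows that if one of them is empty
    then the other is full, so together they contain at least two codewords. *)
Require Import Defs.
From mathcomp Require Import all_boot.

Set Implicit Arguments.
Unset Strict Implicit.
Unset Printing Implicit Defensive.

(** * Self-identifying codes as separating sets *)

Section Separation.
Variable G : sgraph.
Implicit Types (S : {set G}) (u v : G).

(** Condition (2) at [v] keeps [u] out of the intersection, so some codeword [c] near [v] has [u]
    outside its closed neighbourhood; symmetry of adjacency turns this into a statement about
    [c]. *)
Lemma code_separates S u v : self_identifying_code S -> u != v ->
  exists2 c, c \in S & (c \in closed_nbhd v) && (c \notin closed_nbhd u).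
Proof.
move=> [_ /(_ v) [_ capE]] uv.
have /negP u_cap : u \notin \bigcap_(c in closed_nbhd v :&: S) closed_nbhd c.
  by rewrite capE inE.
case: (pickP [pred c in S | (c \in closed_nbhd v) && (c \notin closed_nbhd u)]).
  by move=> c /andP[]; exists c.
move=> noc; case: u_cap; apply/bigcapP => c /setIP[cv cS].
move: (noc c) => /=; rewrite cS cv /= => /negbFE.
by rewrite !inE eq_sym edge_sym.
Qed.

(** Converse of [code_separates]. The pair [u0], [v0] guarantees that every vertex has another one
    to be separated from, which yields the two nonemptiness conditions. *)
Lemma separating_code S (u0 v0 : G) : u0 != v0 ->
  (forall u v, u != v ->
    exists2 c, c \in S & (c \in closed_nbhd v) && (c \notin closed_nbhd u)) ->
  self_identifying_code S.
Proof.
move=> uv0 sep; split.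
  by have [c cS _] := sep _ _ uv0; apply/set0Pn; exists c.
move=> v; split.
  have [u uv] : exists u, u != v.
    by have [<-|] := eqVneq u0 v; [exists v0; rewrite eq_sym | exists u0].
  have [c cS /andP[cv _]] := sep _ _ uv.
  by apply/set0Pn; exists c; rewrite inE cv.
apply/setP => u; rewrite inE; apply/bigcapP/eqP => [u_cap | ->].
  apply/eqP/contraT => /sep[c cS /andP[cv /negP[]]].
  have := u_cap c; rewrite in_setI cv cS => /(_ isT).
  by rewrite !inE eq_sym edge_sym.
by move=> c /setIP[cv _]; move: cv; rewrite !inE eq_sym edge_sym.
Qed.

End Separation.

(** * Codes in direct products, by columns *)

Section ProductCodes.
Variables G H : sgraph.
Implicit Type S : {set direct_product G H}.

Definition column S (j : H) : {set G} := [set i | (i, j) \in S].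

Lemma card_columns S : #|S| = \sum_(j : H) #|column S j|.
Proof.
under eq_bigr do rewrite -sum1_card big_mkcond /=.
rewrite exchange_big pair_bigA -sum1_card big_mkcond /=.
by apply: eq_bigr => -[i j] _; rewrite inE.
Qed.

Lemma code_same_row S (i : G) (j j' : H) : self_identifying_code S -> j != j' ->
  (i, j) \in S \/
  exists x y, [/\ edge i x, edge j y, ~~ edge j' y & (x, y) \in S].
Proof.
move=> codeS jj'; have uv : (i, j') != (i, j) :> direct_product G H.
  by rewrite xpair_eqE eqxx eq_sym.
have [[x y] cS] := code_separates codeS uv.
rewrite !inE /= /direct_rel /= => /andP[/orP[/eqP<-|/andP[ix jy]]]; first by left.
by rewrite ix /= negb_or => /andP[_ j'y]; right; exists x, y.
Qed.

Lemma leaf_in_code S (i : G) (j0 j1 j2 : H) : self_identifying_code S ->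
  (forall y, edge j0 y -> y = j1) -> edge j1 j2 -> j0 != j2 -> (i, j0) \in S.
Proof.
move=> codeS leaf e12 /(code_same_row i codeS)[] // [x [y [_ /leaf-> /negP[]]]].
by rewrite edge_sym.
Qed.

End ProductCodes.

Section K3Codes.
Variable H : sgraph.
Implicit Type S : {set direct_product (complete_graph 3) H}.

(** Let [i], [i'] be the two rows other than [k] and separate [(i', j1)] from [(i, j0)]. These two
    are adjacent, so neither can be the codeword; it is then a neighbour [(x, j1)] of [(i, j0)] with
    [x] different from [i] and [i'], that is, [(k, j1)]. *)
Lemma leaf_nbr_in_code S (k : 'I_3) (j0 j1 : H) : self_identifying_code S ->
  (forall y, edge j0 y -> y = j1) -> edge j0 j1 -> (k, j1) \in S.
Proof.
move=> codeS leaf e01.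
have [i [i' [ii' kP]]] : exists i i' : 'I_3,
    i != i' /\ forall x, x != i -> x != i' -> x = k.
  by case: k => [[|[|[|//]]] k3];
    [ exists (@Ordinal 3 1 isT), (@Ordinal 3 2 isT)
    | exists (@Ordinal 3 0 isT), (@Ordinal 3 2 isT)
    | exists (@Ordinal 3 0 isT), (@Ordinal 3 1 isT) ];
    split=> //; case=> [[|[|[|//]]] x3] // _ _; apply: val_inj.
have uv : (i', j1) != (i, j0) :> direct_product (complete_graph 3) H.
  by rewrite xpair_eqE eq_sym (negbTE ii').
have [[x y] cS] := code_separates codeS uv.
rewrite !inE /= /direct_rel /= /complete_rel.
case/andP=> [/orP[/eqP[-> ->]|/andP[ix /leaf yj1]]].
  by rewrite eq_sym in ii'; rewrite ii' /= (edge_sym j1) e01 orbT.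
rewrite yj1 xpair_eqE eqxx andbT edge_irrefl andbF orbF => xi'.
by rewrite -(kP x) 1?eq_sym // -?yj1 // eq_sym.
Qed.

Lemma card_column_full S (j : H) :
  (forall i, (i, j) \in S) -> #|column S j| = 3.
Proof.
by move=> full; rewrite -[RHS]card_ord -cardsT; apply: eq_card => i; rewrite !inE full.
Qed.

Lemma leaf_columns S (j0 j1 j2 : H) : self_identifying_code S ->
  (forall y, edge j0 y -> y = j1) -> edge j0 j1 -> edge j1 j2 -> j0 != j2 ->
  #|column S j0| = 3 /\ #|column S j1| = 3.
Proof.
move=> codeS leaf e01 e12 n02; split; apply: card_column_full => i.
  exact: leaf_in_code codeS leaf e12 n02.
exact: leaf_nbr_in_code codeS leaf e01.
Qed.

End K3Codes.

(** * Lower bounds for paths *)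

Lemma card_cross_cover (A B : {set 'I_3}) :
  (forall i, i \in A \/ exists2 x, i != x & x \in B) ->
  (forall i, i \in B \/ exists2 x, i != x & x \in A) ->
  2 <= #|A| + #|B|.
Proof.
move=> covA covB.
have [A0|A0] := eqVneq A set0.
  suff -> : B = setT by rewrite cardsT card_ord addnC.
  by apply/setP => i; rewrite inE; have [|[x]] := covB i; rewrite // A0 inE.
have [B0|B0] := eqVneq B set0.
  suff -> : A = setT by rewrite cardsT card_ord.
  by apply/setP => i; rewrite inE; have [|[x]] := covA i; rewrite // B0 inE.
by rewrite -[2]/(1 + 1) leq_add // card_gt0.
Qed.

Notation K3P n := (direct_product (complete_graph 3) (path_graph n)).

(** The condition on [j] selects columns [0], [1], [n - 2] and [n - 1]; these are all the columns
    when [n] is 3 (where the two pairs overlap) or 4. *)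
Lemma path_end_columns n (S : {set K3P n}) (j : 'I_n) :
  2 < n -> self_identifying_code S ->
  [|| j < 2 | n <= j.+2] -> #|column S j| = 3.
Proof.
move=> n_gt2 codeS j_end.
have n0 : 0 < n by exact: leq_trans n_gt2.
have n1 : 1 < n by exact: leq_trans n_gt2.
have m_lt k : 0 < k -> n - k < n by move=> k0; rewrite ltn_subrL k0.
have [c0 c1] : #|column S (Ordinal n0)| = 3 /\ #|column S (Ordinal n1)| = 3.
  apply: (@leaf_columns (path_graph n) _ _ _ (Ordinal n_gt2) codeS) => // y.
  by rewrite /= /path_rel /= orbF => /eqP Ey; apply: val_inj.
have [d0 d1] : #|column S (Ordinal (m_lt 1 isT))| = 3 /\
               #|column S (Ordinal (m_lt 2 isT))| = 3.
  (* Writing the length as [n.+3] lets the subtractions in the last three column indices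
     simplify. *)
  case: n n_gt2 {j j_end n0 n1 c0 c1} S codeS m_lt => [|[|[|n]]] // _ S codeS m_lt.
  apply: (@leaf_columns (path_graph n.+3) _ _ _ (Ordinal (m_lt 3 isT)) codeS).
  - move=> y; rewrite /= /path_rel /= !subSS !subn0.
    case/orP=> /eqP Ey; last by apply: val_inj; case: Ey; rewrite /= !subSS subn0.
    by have := ltn_ord y; rewrite -Ey ltnn.
  - by rewrite /= /path_rel /= !subSS !subn0 eqxx orbT.
  - by rewrite /= /path_rel /= !subSS !subn0 eqxx orbT.
  - by rewrite -val_eqE /= !subSS !subn0 gtn_eqF // ltnW.
have col k (kn : k < n) :
    val j = k -> #|column S (Ordinal kn)| = 3 -> #|column S j| = 3.
  by move=> jk; have -> : Ordinal kn = j by apply: val_inj.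
have [jn|jn] := leqP n j.+2; last first.
  move: j_end; rewrite (leqNgt n) jn orbF ltnS leq_eqVlt ltnS leqn0.
  by case/orP=> /eqP jk; [apply: col jk c1 | apply: col jk c0].
have [jn1|jn1] := leqP n j.+1.
  apply: col d0; apply/eqP; rewrite -(eqn_add2r 1) subnK // addn1.
  by rewrite eqn_leq jn1 ltn_ord.
apply: col d1; apply/eqP; rewrite -(eqn_add2r 2) subnK // addn2.
by rewrite eqn_leq jn jn1.
Qed.

Lemma card_code_ge9 (S : {set K3P 3}) : self_identifying_code S -> 9 <= #|S|.
Proof.
move=> codeS; rewrite card_columns /= !big_ord_recl big_ord0.
by rewrite !path_end_columns.
Qed.

Lemma card_code_ge12_4 (S : {set K3P 4}) : self_identifying_code S -> 12 <= #|S|.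
Proof.
move=> codeS; rewrite card_columns /= !big_ord_recl big_ord0.
by rewrite !path_end_columns.
Qed.

Lemma card_code_ge12_5 (S : {set K3P 5}) : self_identifying_code S -> 12 <= #|S|.
Proof.
move=> codeS; rewrite card_columns /= (bigD1 (inord 2)) //=.
(* The middle column may be empty, so its term is discarded. *)
apply: leq_trans (leq_addl _ _).
rewrite (eq_bigr (fun=> 3)) => [|j]; last first.
  rewrite -val_eqE /= inordK // => j2; apply: path_end_columns => //.
  by case: j j2 => [[|[|[|[|[|]]]]]].
by rewrite sum_nat_const (eq_card (B := predC1 (inord 2))) // cardC1 card_ord.
Qed.

Lemma card_code_ge14 (S : {set K3P 6}) : self_identifying_code S -> 14 <= #|S|.
Proof.
move=> codeS; pose o k (k6 : k < 6) : path_graph 6 := Ordinal k6.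
have cov (j j' y : path_graph 6) : j != j' ->
    (forall x, edge j x -> ~~ edge j' x -> x = y) ->
    forall i, i \in column S j \/ exists2 x, i != x & x \in column S y.
  move=> jj' onlyy i; have [|[x [z [ix jz j'z zS]]]] := code_same_row i codeS jj'.
    by left; rewrite inE.
  by right; exists x => //; rewrite inE -(onlyy z).
have mid : 2 <= #|column S (o 2 isT)| + #|column S (o 3 isT)|.
  (* Columns 2 and 0 share the neighbour 1, which leaves 3 for column 2; symmetrically, columns 3
     and 5 share 4, which leaves 2 for column 3. *)
  apply: card_cross_cover.
    apply: (cov _ (o 0 isT)) => //.
    by case=> [[|[|[|[|[|[|]]]]]] ?] // _ _; apply: val_inj.
  apply: (cov _ (o 5 isT)) => //.
  by case=> [[|[|[|[|[|[|]]]]]] ?] // _ _; apply: val_inj.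
rewrite card_columns /= (bigD1 (o 2 isT)) // (bigD1 (o 3 isT)) //= addnA.
rewrite -[14]/(2 + 12) leq_add // (eq_bigr (fun=> 3)) => [|j]; last first.
  move=> jmid; apply: path_end_columns => //.
  by case: j jmid => [[|[|[|[|[|[|]]]]]]].
(* The number of outer columns, unfolded as a sum of indicators, evaluates to 4. *)
rewrite sum_nat_const -sum1_card big_mkcond /= !big_ord_recl big_ord0.
by [].
Qed.

(** * Upper bounds by computation on explicit codes *)

Section Witness.
Variable n : nat.

Definition grid : seq (nat * nat) := [seq (i, j) | i <- iota 0 3, j <- iota 0 n].

Definition nbhdb (v c : nat * nat) :=
  (c == v) || (v.1 != c.1) && ((v.2.+1 == c.2) || (c.2.+1 == v.2)).

(* Vertices are coded as pairs of naturals so that this test runs by mere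
   computation, which enumerations of ordinals and finite sets block. *)
Definition separatesb (P : pred (nat * nat)) :=
  all (fun v => all (fun u => (u == v) ||
    has (fun c => [&& P c, nbhdb v c & ~~ nbhdb u c]) grid) grid) grid.

Definition set_of_pred (P : pred (nat * nat)) : {set K3P n} :=
  [set x : K3P n | P (val x.1, val x.2)].

Lemma set_of_pred_code (P : pred (nat * nat)) :
  0 < n -> separatesb P -> self_identifying_code (set_of_pred P).
Proof.
move=> n0 sepP.
have gridP (x : K3P n) : (val x.1, val x.2) \in grid.
  by apply/allpairsP; exists (val x.1, val x.2); rewrite !mem_iota /= !ltn_ord.
have nbhdE (v c : K3P n) :
    (c \in closed_nbhd v) = nbhdb (val v.1, val v.2) (val c.1, val c.2).
  by case: v c => [i j] [i' j']; rewrite !inE.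
apply: (@separating_code (K3P n) _ (@Ordinal 3 0 isT, Ordinal n0)
                             (@Ordinal 3 1 isT, Ordinal n0)) => // u v uv.
have /allP/(_ _ (gridP v))/allP/(_ _ (gridP u)) := sepP.
have -> /= : ((val u.1, val u.2) == (val v.1, val v.2)) = false.
  by apply: negbTE; case: u v uv => [i j] [i' j'].
case/hasP=> c /allpairsP[[i j] []]; rewrite !mem_iota => i3 jn -> {c}.
case/and3P=> Pc vc uc; exists ((Ordinal i3, Ordinal jn) : K3P n).
  by rewrite inE.
by rewrite !nbhdE vc.
Qed.

Lemma card_set_of_pred (P : pred (nat * nat)) : #|set_of_pred P| = count P grid.
Proof.
pose F i j := if P (i, j) then 1 else 0.
have -> : count P grid = \sum_(i <- iota 0 3) \sum_(j <- iota 0 n) F i j.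
  by rewrite -sum1_count big_mkcond big_allpairs.
rewrite -[iota 0 3]/(index_iota 0 3) big_mkord.
have -> : iota 0 n = index_iota 0 n by rewrite /index_iota subn0.
under [RHS]eq_bigr do rewrite big_mkord.
rewrite pair_bigA -sum1_card big_mkcond /=.
by apply: eq_bigr => -[i j] _; rewrite inE.
Qed.

Lemma is_gammaSID_of_pred (P : pred (nat * nat)) k :
  0 < n -> separatesb P -> count P grid = k ->
  (forall S : {set K3P n}, self_identifying_code S -> k <= #|S|) ->
  is_gammaSID (K3P n) k.
Proof.
move=> n0 sepP Pk lb; split=> //; exists (set_of_pred P).
by rewrite card_set_of_pred; split=> //; apply: set_of_pred_code.
Qed.

End Witness.

Theorem theoremA1 (n : nat) :
  [/\ n = 3 ->
        is_gammaSID (direct_product (complete_graph 3) (path_graph n)) 9,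
      n = 4 \/ n = 5 ->
        is_gammaSID (direct_product (complete_graph 3) (path_graph n)) 12
    & n = 6 ->
        is_gammaSID (direct_product (complete_graph 3) (path_graph n)) 14].
Proof.
split=> [->|[->|->]|->].
(* For lengths 3 and 4 the bound is the total number of vertices. Length 5 omits the middle column,
   and length 6 keeps only row 0 in the two middle columns, giving 12 + 2. *)
- by apply: (is_gammaSID_of_pred (P := predT)) => // S; apply: card_code_ge9.
- by apply: (is_gammaSID_of_pred (P := predT)) => // S; apply: card_code_ge12_4.
- by apply: (is_gammaSID_of_pred (P := fun x => x.2 != 2)) => // S;
    apply: card_code_ge12_5.
- by apply: (is_gammaSID_of_pred
      (P := fun x => (x.1 == 0) || (x.2 \notin [:: 2; 3]))) => // S;
    apply: card_code_ge14.
Qed.
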